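(* Let $M,N\ge 1$ be integers, let $F_0,\ldots,F_N\in\mathbb{C}^{2M\times 2M}$, and let $F(\xi)=\sum_{j=0}^N F_j\xi^j$ be the corresponding polynomial map of degree $N$. Let $B$ and $D$ be the matrices built from $F_0,\dots,F_N$ as in the context. If $F$ satisfies the QMF-condition $$I-F^*(\xi)F(\xi)=0\quad\text{for all }\xi\in\mathbb{C},\ |\xi|=1,$$ then $$B\,D^N=0.$$
   Context: Notation: $X^*$ is the conjugate transpose of a matrix $X$, and $F^*(\xi)=(F(\xi))^*=\sum_{j=0}^N F_j^*\bar\xi^{\,j}$; $I$ denotes identity matrices of the appropriate size. The words ''degree $N$'' refer to the expansion $F(\xi)=\sum_{j=0}^N F_j\xi^j$. Definition of $A,B,C,D$: The $2M(N+1)\times 2M(N+1)$ block matrix $\begin{pmatrix}A&B\\ C&D\end{pmatrix}$, with $A$ of size $2M\times 2M$, $B$ of size $2M\times 2MN$, $C$ of size $2MN\times 2M$ and $D$ of size $2MN\times 2MN$, is $$\begin{pmatrix}A&B\\ C&D\end{pmatrix}=E\cdot\begin{pmatrix}I_{2M}&0\\ 0&U\end{pmatrix},$$ where $E$ is the block circulant matrix $$E=\begin{pmatrix}F_0&F_N&\cdots&\cdots&F_1\\ F_1&F_0&F_N&&\vdots\\ \vdots&F_1&\ddots&\ddots&\vdots\\ \vdots&&\ddots&\ddots&F_N\\ F_N&F_{N-1}&\cdots&F_1&F_0\end{pmatrix},$$ that is, with block indices $i,j\in\{0,\dots,N\}$, the $(i,j)$ block of $E$ is $F_{(i-j)\bmod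 (N+1)}$; and $U$ is the $2MN\times2MN$ block circulant matrix $$U=\begin{pmatrix}F_0^*+F_N^*&F_1^*&\cdots&F_{N-1}^*\\ F_{N-1}^*&\ddots&\ddots&\vdots\\ \vdots&\ddots&\ddots&F_1^*\\ F_1^*&\cdots&F_{N-1}^*&F_0^*+F_N^*\end{pmatrix},$$ that is, with block indices $i,j\in\{1,\dots,N\}$, the $(i,i)$ blocks are $F_0^*+F_N^*$ and, for $i\ne j$, the $(i,j)$ block is $F^*_{(j-i)\bmod N}$ (for $N=1$, $U=F_0^*+F_1^*$). *)

(* Defs.v *)
From mathcomp Require Import all_boot all_order all_algebra spectral complex reals.

Set Implicit Arguments.
Unset Strict Implicit.
Unset Printing Implicit Defensive.

Import GRing.Theory Num.Theory.

Local Open Scope ring_scope.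
Local Open Scope sesquilinear_scope.
Local Open Scope complex_scope.

(* The coefficients F_0, ..., F_N are a family F : 'I_N.+1 -> 'M[C]_m; nothing
   is assumed about F_N, so "degree N" only refers to the length of the
   expansion.  The block size m stands for 2M. *)

Definition Fmap (C : numClosedFieldType) (m N : nat)
    (F : 'I_N.+1 -> 'M[C]_m) (xi : C) : 'M[C]_m :=
  \sum_(j < N.+1) xi ^+ j *: F j.

Definition QMF (C : numClosedFieldType) (m N : nat)
    (F : 'I_N.+1 -> 'M[C]_m) : Prop :=
  forall xi : C, `|xi| = 1 -> 1%:M - (Fmap F xi) ^t* *m Fmap F xi = 0.

Definition Eblock (C : numClosedFieldType) (m N : nat)
    (F : 'I_N.+1 -> 'M[C]_m) (i j : 'I_N.+1) : 'M[C]_m :=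
  F (inord ((i + N.+1 - j) %% N.+1)%N).

(* The cast only regroups the block sizes \sum_(i < N.+1) m as
   m + \sum_(i < N) m, separating block index 0 from 1, ..., N. *)
Definition Emx (C : numClosedFieldType) (m N : nat)
    (F : 'I_N.+1 -> 'M[C]_m) : 'M[C]_(m + \sum_(i < N) m) :=
  let e := esym (@mxsize_recl N (fun=> m)) in
  castmx (e, e) (\mxblock_(i < N.+1, j < N.+1) Eblock F i j).

(* Block indices run over 0, ..., N-1 here instead of 1, ..., N; the entries
   depend on them only through j - i mod N. *)
Definition Ublock (C : numClosedFieldType) (m N : nat)
    (F : 'I_N.+1 -> 'M[C]_m) (i j : 'I_N) : 'M[C]_m :=
  if i == j then (F ord0) ^t* + (F ord_max) ^t*
  else (F (inord ((j + N - i) %% N)%N)) ^t*.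

Definition Umx (C : numClosedFieldType) (m N : nat)
    (F : 'I_N.+1 -> 'M[C]_m) : 'M[C]_(\sum_(i < N) m) :=
  \mxblock_(i < N, j < N) Ublock F i j.

Definition ABCDmx (C : numClosedFieldType) (m N : nat)
    (F : 'I_N.+1 -> 'M[C]_m) : 'M[C]_(m + \sum_(i < N) m) :=
  Emx F *m block_mx 1%:M 0 0 (Umx F).

Definition Bmx (C : numClosedFieldType) (m N : nat)
    (F : 'I_N.+1 -> 'M[C]_m) : 'M[C]_(m, \sum_(i < N) m) :=
  ursubmx (ABCDmx F).

Definition Dmx (C : numClosedFieldType) (m N : nat)
    (F : 'I_N.+1 -> 'M[C]_m) : 'M[C]_(\sum_(i < N) m) :=
  drsubmx (ABCDmx F).

(* Main.v *)
Require Import Defs.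
From mathcomp Require Import all_boot all_order all_algebra complex reals.
From mathcomp Require Import spectral ring zify.

(** Read a block column [v] of size [N] as a polynomial [p] with exponents
    1, ..., [N].  Split [F^* p = u_+ + u_-], where [u_+] carries the exponents
    [>= 1] and [u_-] the exponents [<= 0].  Since [F F^* = 1], also
    [p = F u_+ + F u_-].  Here [F u_+] has only exponents [>= 1] and [F u_-]
    only exponents [<= N]; as their sum [p] has exponents 1, ..., [N], so has
    each of them.  Reducing
    modulo [xi^N - 1] (the matrix [U]) moves [u_-] to [xi^N u_-], multiplying by
    [F] modulo [xi^(N+1) - 1] (the matrix [E]) then yields
    [F u_+ + xi^-1 F u_-].  Thus [B v] is the coefficient of exponent 1 in
    [F u_-], and [D v] is [F u_+] plus the backward shift of [F u_-] in which
    that coefficient is dropped.  Iterating, [D] leaves the part [F u_+] alone,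
    which [B] does not see, and shifts the part [F u_-] out after [N] steps.

    In matrices, let [T] ([lowermx]) be the block lower triangular Toeplitz
    matrix of [v |-> F u_+] on nonnegative powers, and [K_t] ([uppermx t]) the
    block upper triangular Toeplitz matrix made of the remaining coefficients
    of [F], moved up by [t] block rows.  Then [U = (T + K_0)^*], the lower right
    part of [E] is [T + K_1], and the upper right part is the first block row of
    [K_0].  The coefficient identities
    [sum_j F_j^* F_(j+d) = sum_j F_(j+d) F_j^* = delta_(d,0)] give
    [K_t T^* = 0], [T K_t^* = 0], [T^* K_t = 0] and [T T^* + K_0 K_0^* = 1].
    Hence [P = K_0 K_0^*] satisfies [P D = K_1 K_0^*]
    ([upper_gram_mul_Dmx]): multiplication by [D] turns each block row of [P]
    into the next one, and the last into 0.  As [B] is the first block row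
    of [P], the product [B D^N] vanishes. *)

Set Implicit Arguments.
Unset Strict Implicit.
Unset Printing Implicit Defensive.

Import GRing.Theory Num.Theory.

Local Open Scope ring_scope.
Local Open Scope sesquilinear_scope.

(** * Laurent polynomials on the unit circle *)

(** The unit circle is infinite: it contains the pairwise distinct points
    [(n + i) / (n - i)], [n] a natural number. *)
Lemma poly_unit_circle_eq0 (C : numClosedFieldType) (p : {poly C}) :
  (forall x, `|x| = 1 -> p.[x] = 0) -> p = 0.
Proof.
move=> p0; apply/eqP/negPn/negP => p_neq0.
pose z (n : nat) : C := (n%:R + 'i) / (n%:R - 'i).
have conjz n : (n%:R - 'i : C) = (n%:R + 'i)^*.
  by rewrite rmorphD /= conjC_nat conjCi.
have num_neq0 n : n%:R + 'i != 0 :> C.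
  apply/eqP => /(congr1 (fun x => 'Im x)).
  rewrite raddfD /= Im_i raddf0 (Creal_ImP _ _) ?realn // add0r.
  by move/eqP; rewrite oner_eq0.
have den_neq0 n : n%:R - 'i != 0 :> C by rewrite conjz conjC_eq0.
have z_inj : injective z.
  move=> a b /eqP; rewrite /z eqr_div // -subr_eq0.
  have -> : (a%:R + 'i) * (b%:R - 'i) - (b%:R + 'i) * (a%:R - 'i)
     = 2%:R * 'i * (b%:R - a%:R) :> C by ring.
  rewrite mulf_eq0 mulf_eq0 pnatr_eq0 (negPf (neq0Ci C)) /= subr_eq0 eqr_nat.
  by move/eqP.
have := max_poly_roots p_neq0 (rs := map z (iota 0 (size p))).
rewrite map_inj_uniq // iota_uniq size_map size_iota ltnn => H.
suff: false by []; apply: H => //.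
apply/allP => _ /mapP[n _ ->]; apply/rootP/p0.
by rewrite normf_div conjz norm_conjC divff // normr_eq0.
Qed.

(** On the unit circle [x^* = x^-1], so that the hypothesis is an identity
    between Laurent polynomials in [x]; multiplied by [x ^+ N], it becomes one
    between polynomials.  The conclusion compares coefficients of degree
    [N + d]. *)
Lemma laurent_lag_sum (C : numClosedFieldType) (m N : nat)
    (G : nat -> nat -> 'M[C]_m) :
  (forall x : C, `|x| = 1 ->
     \sum_(j < N.+1) \sum_(k < N.+1) (x^* ^+ j * x ^+ k) *: G j k = 1%:M) ->
  forall d, \sum_(j < N.+1 | (j + d <= N)%N) G j (j + d)%N = (d == 0)%:R%:M.
Proof.
move=> Gx d; apply/matrixP => a b.
pose p : {poly C} := \sum_(j < N.+1) \sum_(k < N.+1)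
  G j k a b *: 'X^(N - j + k) - (a == b)%:R *: 'X^N.
have p0 : p = 0.
  apply: poly_unit_circle_eq0 => x x1.
  have x_neq0 : x != 0 by rewrite -normr_eq0 x1 oner_eq0.
  have xconj : x^* = x^-1 by rewrite invC_norm x1 expr1n invr1 mul1r.
  rewrite /p hornerD hornerN hornerZ hornerXn horner_sum.
  have /matrixP/(_ a b) := Gx x x1; rewrite [RHS]mxE => <-.
  apply/eqP; rewrite subr_eq0; apply/eqP.
  rewrite summxE mulr_suml; apply: eq_bigr => j _.
  rewrite summxE mulr_suml horner_sum; apply: eq_bigr => k _.
  have jN : (j <= N)%N by rewrite -ltnS.
  rewrite !mxE hornerZ hornerXn exprD xconj exprVn expfB_cond ?(negPf x_neq0) //.
  by ring.
have lead : (N + d == N)%N = (d == 0).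
  by rewrite -[X in _ == X](addn0 N) eqn_add2l.
have /(congr1 (fun q : {poly C} => q`_(N + d))) := p0.
rewrite /p coefB coefZ coefXn coef0 lead => /eqP.
rewrite subr_eq0 => /eqP pE; rewrite [RHS]mxE -[RHS]mulr_natr [RHS]mulrC -{}pE.
rewrite summxE big_mkcond coef_sum; apply: eq_bigr => j _ /=.
have jN : (j <= N)%N by rewrite -ltnS.
have lag (k : 'I_N.+1) : (N + d == N - j + k)%N = (k == j + d :> nat)%N by lia.
rewrite coef_sum; under eq_bigr => k _ do rewrite coefZ coefXn lag.
case: ifP => jdN; last first.
  rewrite big1 // => k _; case: eqP => [kjd|]; last by rewrite mulr0.
  by move: jdN; rewrite -kjd -ltnS ltn_ord.
rewrite (bigD1 (Ordinal (jdN : (j + d < N.+1)%N))) //= eqxx mulr1.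
rewrite big1 ?addr0 // => k; rewrite -val_eqE /= => /negPf ->.
by rewrite mulr0.
Qed.

(** * Coefficient identities of a QMF filter *)

Lemma adj_mulmx (C : numClosedFieldType) (m n p : nat)
    (A : 'M[C]_(m, n)) (B : 'M[C]_(n, p)) : (A *m B)^t* = B^t* *m A^t*.
Proof. by rewrite trmx_mul map_mxM. Qed.

(** Extending the coefficients by 0 lets the blocks of all the Toeplitz
    matrices below be indexed by natural numbers, and their support be expressed
    by vanishing coefficients. *)
Definition coefs (C : numClosedFieldType) (m N : nat)
    (F : 'I_N.+1 -> 'M[C]_m) (k : nat) : 'M[C]_m :=
  if (k <= N)%N then F (inord k) else 0.

Lemma coefs_out (C : numClosedFieldType) (m N : nat)
    (F : 'I_N.+1 -> 'M[C]_m) k : (N < k)%N -> coefs F k = 0.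
Proof. by rewrite /coefs ltnNge => /negPf ->. Qed.

Lemma coefs_ord (C : numClosedFieldType) (m N : nat)
    (F : 'I_N.+1 -> 'M[C]_m) (k : 'I_N.+1) : coefs F k = F k.
Proof. by rewrite /coefs -ltnS ltn_ord inord_val. Qed.

Lemma FmapE (C : numClosedFieldType) (m N : nat)
    (F : 'I_N.+1 -> 'M[C]_m) x :
  Fmap F x = \sum_(j < N.+1) x ^+ j *: coefs F j.
Proof. by apply: eq_bigr => j _; rewrite coefs_ord. Qed.

Lemma adj_Fmap (C : numClosedFieldType) (m N : nat)
    (F : 'I_N.+1 -> 'M[C]_m) x :
  (Fmap F x)^t* = \sum_(j < N.+1) x^* ^+ j *: (coefs F j)^t*.
Proof.
rewrite FmapE raddf_sum raddf_sum; apply: eq_bigr => j _ /=.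
by rewrite linearZ map_mxZ rmorphXn.
Qed.

Section Correlations.

Variables (C : numClosedFieldType) (m N : nat) (F : 'I_N.+1 -> 'M[C]_m).
Hypothesis hF : QMF F.
Local Notation f := (coefs F).

Lemma QMF_corr_adj_mul d :
  \sum_(j < N.+1) (f j)^t* *m f (j + d) = (d == 0)%:R%:M.
Proof.
rewrite -(laurent_lag_sum (N := N) (G := fun j k => (f j)^t* *m f k)).
  rewrite [RHS]big_mkcond; apply: eq_bigr => j _ /=.
  by case: leqP => // /coefs_out ->; rewrite mulmx0.
move=> x x1; have /eqP := hF x1; rewrite subr_eq0 => /eqP ->.
rewrite adj_Fmap FmapE mulmx_suml; apply: eq_bigr => j _.
rewrite mulmx_sumr; apply: eq_bigr => k _.
by rewrite -scalemxAl -scalemxAr scalerA.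
Qed.

(** The blocks are square, so that [F^* F = 1] on the circle implies
    [F F^* = 1] there. *)
Lemma QMF_corr_mul_adj d :
  \sum_(j < N.+1) f (j + d) *m (f j)^t* = (d == 0)%:R%:M.
Proof.
rewrite -(laurent_lag_sum (N := N) (G := fun j k => f k *m (f j)^t*)).
  rewrite [RHS]big_mkcond; apply: eq_bigr => j _ /=.
  by case: leqP => // /coefs_out ->; rewrite mul0mx.
move=> x x1; have /eqP := hF x1; rewrite subr_eq0 => /eqP /esym/mulmx1C <-.
rewrite adj_Fmap FmapE mulmx_sumr; apply: eq_bigr => j _.
rewrite mulmx_suml; apply: eq_bigr => k _.
by rewrite -scalemxAl -scalemxAr scalerA mulrC.
Qed.

Lemma QMF_corr_mul_adj_lag d :
  \sum_(j < N.+1) f j *m (f (j + d))^t* = (d == 0)%:R%:M.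
Proof.
have /(congr1 (fun A => A^t*)) := QMF_corr_mul_adj d.
rewrite tr_scalar_mx map_scalar_mx rmorph_nat => <-.
rewrite raddf_sum raddf_sum; apply: eq_bigr => j _ /=.
by rewrite adj_mulmx trmxCK.
Qed.

End Correlations.

(** * Reindexing of sums along a Toeplitz row or column *)

Section ToeplitzSums.

Variables (V : nmodType) (N : nat).

Lemma sum_widen (g : nat -> V) n p : (n <= p)%N ->
  (forall j, (n <= j < p)%N -> g j = 0) ->
  \sum_(j < n) g j = \sum_(j < p) g j.
Proof.
move=> np g0; rewrite (big_ord_widen p g np) [LHS]big_mkcond.
apply: eq_bigr => j _; case: ltnP => // nj.
by rewrite g0 // nj ltn_ord.
Qed.

Lemma sum_reflect (g : nat -> V) i : (i < N)%N ->
  \sum_(s < N) (if (s <= i)%N then g (i - s)%N else 0) = \sum_(j < i.+1) g j.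
Proof.
move=> iN.
rewrite -(big_mkord xpredT (fun s => if (s <= i)%N then g (i - s)%N else 0)).
rewrite (big_cat_nat (n := i.+1)) //= [X in _ + X]big_nat.
rewrite [X in _ + X]big1 ?addr0; last first.
  by move=> s /andP[+ _]; rewrite ltnNge => /negPf ->.
rewrite big_mkord (reindex_inj rev_ord_inj) /=; apply: eq_bigr => s _.
by rewrite subSS leq_subr subKn // -ltnS.
Qed.

Lemma sum_shift (g : nat -> V) i : (i < N)%N ->
  (forall j, (N - i <= j)%N -> g j = 0) ->
  \sum_(l < N) (if (i <= l)%N then g (l - i)%N else 0) = \sum_(j < N.+1) g j.
Proof.
move=> iN g0.
rewrite -(@sum_widen g (N - i)) ?(leqW (leq_subr _ _)) //; last first.
  by move=> j /andP[+ _]; exact: g0.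
rewrite -(big_mkord xpredT (fun l => if (i <= l)%N then g (l - i)%N else 0)).
rewrite (big_cat_nat (n := i)) ?(ltnW iN) //= big_nat big1 ?add0r; last first.
  by move=> l /andP[_]; rewrite ltnNge => /negPf ->.
rewrite -{1}(add0n i) big_addn big_mkord.
by apply: eq_bigr => j _; rewrite leq_addl addnK.
Qed.

(** The first sum covers the indices [0, ..., i] and the second [i + 1, ...,
    i + N], both in decreasing order. *)
Lemma sum_reflect_shift (g : nat -> V) i : (i < N)%N ->
  (forall j, (N < j)%N -> g j = 0) ->
  \sum_(s < N) (if (s <= i)%N then g (i - s)%N else 0)
    + \sum_(s < N) g (i + (N - s))%N = \sum_(j < N.+1) g j.
Proof.
move=> iN g0; rewrite sum_reflect //.
rewrite (@sum_widen g N.+1 (i.+1 + N)) ?addSn ?ltnS ?leq_addl //; last first.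
  by move=> j /andP[+ _]; exact: g0.
rewrite -addSn big_split_ord /=; congr (_ + _).
rewrite (reindex_inj rev_ord_inj) /=; apply: eq_bigr => s _.
by congr g; have := ltn_ord s; lia.
Qed.

End ToeplitzSums.

(** * The two Toeplitz factors of B and D *)

Section Realization.

Variables (C : numClosedFieldType) (m N : nat) (F : 'I_N.+1 -> 'M[C]_m).
Hypothesis hF : QMF F.
Local Notation f := (coefs F).

Definition lower (i s : nat) : 'M[C]_m := if (s <= i)%N then f (i - s) else 0.

(** For [t = 0] this is the coefficient of [F] that takes the exponent
    [s + 1 - N] to [i + 1]: column [s], which belongs to the exponent [s + 1],
    stands for the component of [u_-] that reduction modulo [xi^N - 1] moves
    there.  The parameter [t] shifts the rows upwards. *)
Definition upper (t i s : nat) : 'M[C]_m := f (i + (N - s) + t).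

(** The three products below are correlations of the coefficients at a lag
    [d > 0]; each of them is complete because the coefficients beyond the range
    of the matrix product vanish. *)
Lemma upper_lower_adj t i l : (l < N)%N ->
  \sum_(s < N) upper t i s *m (lower l s)^t* = 0.
Proof.
move=> lN; pose d := (i + (N - l) + t)%N.
pose g j := f (j + d) *m (f j)^t*.
rewrite (eq_bigr (fun s : 'I_N => if (s <= l)%N then g (l - s)%N else 0)).
  rewrite sum_reflect // (@sum_widen _ g l.+1 N.+1) ?ltnS ?(ltnW lN) //.
    rewrite QMF_corr_mul_adj // (_ : (d == 0)%N = false) ?raddf0 //.
    by rewrite /d; lia.
  by move=> j /andP[lj _]; rewrite /g coefs_out ?mul0mx // /d; lia.
move=> s _; rewrite /lower; case: leqP => [sl|_]; last first.
  by rewrite trmx0 map_mx0 mulmx0.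
by rewrite /g /upper; congr (f _ *m _); rewrite /d; have := ltn_ord s; lia.
Qed.

Lemma lower_upper_adj t i l : (i < N)%N ->
  \sum_(s < N) lower i s *m (upper t l s)^t* = 0.
Proof.
move=> iN; pose d := (l + (N - i) + t)%N.
pose g j := f j *m (f (j + d))^t*.
rewrite (eq_bigr (fun s : 'I_N => if (s <= i)%N then g (i - s)%N else 0)).
  rewrite sum_reflect // (@sum_widen _ g i.+1 N.+1) ?ltnS ?(ltnW iN) //.
    rewrite QMF_corr_mul_adj_lag // (_ : (d == 0)%N = false) ?raddf0 //.
    by rewrite /d; lia.
  move=> j /andP[lj _].
  by rewrite /g (@coefs_out _ _ _ F (j + d)) ?trmx0 ?map_mx0 ?mulmx0 // /d; lia.
move=> s _; rewrite /lower; case: leqP => [sl|_]; last by rewrite mul0mx.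
by rewrite /g /upper; congr (_ *m (f _)^t*); rewrite /d; have := ltn_ord s; lia.
Qed.

Lemma lower_adj_upper t i s : (i < N)%N -> (s < N)%N ->
  \sum_(l < N) (lower l i)^t* *m upper t l s = 0.
Proof.
move=> iN sN; pose d := (i + (N - s) + t)%N.
pose g j := (f j)^t* *m f (j + d).
rewrite (eq_bigr (fun l : 'I_N => if (i <= l)%N then g (l - i)%N else 0)).
  rewrite sum_shift //.
    rewrite QMF_corr_adj_mul // (_ : (d == 0)%N = false) ?raddf0 //.
    by rewrite /d; lia.
  by move=> j jN; rewrite /g (@coefs_out _ _ _ F (j + d)) ?mulmx0 // /d; lia.
move=> l _; rewrite /lower; case: leqP => [il|_]; last first.
  by rewrite trmx0 map_mx0 mul0mx.
by rewrite /g /upper; congr (_ *m f _); rewrite /d; lia.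
Qed.

(** The two sums are the two halves of one correlation at lag [|i - l|]. *)
Lemma lower_upper_gram i l : (i < N)%N -> (l < N)%N ->
  \sum_(s < N) lower i s *m (lower l s)^t*
    + \sum_(s < N) upper 0 i s *m (upper 0 l s)^t* = (i == l)%:R%:M.
Proof.
move=> iN lN; have [il|li] := leqP i l.
  pose g j := f j *m (f (j + (l - i)))^t*.
  rewrite (_ : (i == l) = ((l - i)%N == 0)); last by lia.
  rewrite -(QMF_corr_mul_adj_lag hF) -(@sum_reflect_shift _ _ g i iN); last first.
    by move=> j jN; rewrite /g coefs_out ?mul0mx.
  congr (_ + _); apply: eq_bigr => s _; last first.
    by rewrite /g /upper; congr (f _ *m (f _)^t*); lia.
  rewrite /lower; case: leqP => si; last by rewrite mul0mx.
  by rewrite (leq_trans si il) /g; congr (_ *m (f _)^t*); lia.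
pose g j := f (j + (i - l)) *m (f j)^t*.
rewrite (_ : (i == l) = ((i - l)%N == 0)); last by lia.
rewrite -(QMF_corr_mul_adj hF) -(@sum_reflect_shift _ _ g l lN); last first.
  by move=> j jN; rewrite /g (@coefs_out _ _ _ F j) // trmx0 map_mx0 mulmx0.
congr (_ + _); apply: eq_bigr => s _; last first.
  by rewrite /g /upper; congr (f _ *m (f _)^t*); lia.
rewrite /lower; case: (leqP s l) => sl; last by rewrite trmx0 map_mx0 mulmx0.
by rewrite (leq_trans sl (ltnW li)) /g; congr (f _ *m _); lia.
Qed.

Definition lowermx : 'M[C]_(\sum_(i < N) m) :=
  \mxblock_(i < N, s < N) lower i s.
Definition uppermx t : 'M[C]_(\sum_(i < N) m) :=
  \mxblock_(i < N, s < N) upper t i s.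

Lemma adj_mxblock (G : 'I_N -> 'I_N -> 'M[C]_m) :
  (\mxblock_(i < N, s < N) G i s)^t* = \mxblock_(s < N, i < N) (G i s)^t*.
Proof. by rewrite tr_mxblock; apply/matrixP => i j; rewrite !mxE. Qed.

Lemma mulmx_upper_lower_adj t : uppermx t *m lowermx^t* = 0.
Proof.
rewrite adj_mxblock mul_mxblock -[RHS]mxblock0; apply: eq_mxblock => i l.
exact: upper_lower_adj.
Qed.

Lemma mulmx_lower_upper_adj t : lowermx *m (uppermx t)^t* = 0.
Proof.
rewrite adj_mxblock mul_mxblock -[RHS]mxblock0; apply: eq_mxblock => i l.
exact: lower_upper_adj.
Qed.

Lemma mulmx_lower_adj_upper t : lowermx^t* *m uppermx t = 0.
Proof.
rewrite adj_mxblock mul_mxblock -[RHS]mxblock0; apply: eq_mxblock => i l.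
exact: lower_adj_upper.
Qed.

Lemma lower_upper_coisometry :
  lowermx *m lowermx^t* + uppermx 0 *m (uppermx 0)^t* = 1%:M.
Proof.
rewrite !adj_mxblock !mul_mxblock -mxblockD -mxdiagZ /mxdiag.
apply: eq_mxblock => i l; rewrite lower_upper_gram //.
by rewrite conform_mx_id -val_eqE /=; case: eqP => // _; rewrite raddf0.
Qed.

(** Index arithmetic modulo [N]: off the diagonal exactly one of [j - i] and
    [j + N - i] lies between 0 and [N]; on the diagonal both do, which gives the
    two terms [F_0^*] and [F_N^*]. *)
Lemma UmxE : Umx F = (lowermx + uppermx 0)^t*.
Proof.
rewrite -mxblockD adj_mxblock; apply: eq_mxblock => i j.
rewrite /Ublock raddfD raddfD /= /lower /upper addn0.
have [iN jN] := (ltn_ord i, ltn_ord j).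
case: eqP => [->|/eqP]; rewrite -?val_eqE.
  by rewrite leqnn subnn subnKC ?(ltnW jN) // -!coefs_ord.
move=> ij; have [le_ij|lt_ji] := leqP i j.
  have lt_ij : (i < j)%N by rewrite ltn_neqAle ij.
  rewrite (@coefs_out _ _ _ F (j + (N - i))) ?trmx0 ?map_mx0 ?addr0; last by lia.
  rewrite -addnBAC // modnDr modn_small; last by lia.
  by rewrite /coefs ifT //; lia.
rewrite trmx0 map_mx0 add0r modn_small; last by lia.
by rewrite /coefs ifT ?addnBA //; lia.
Qed.

(** Index arithmetic modulo [N + 1]: above the diagonal the wrapped index is
    [N + 1 + i - s], one more than in the matrix [U]; hence [uppermx 1] here
    where [U] has [uppermx 0]. *)
Lemma Emx_block :
  Emx F = block_mx (Eblock F 0 0) (\mxrow_(s < N) upper 0 0 s)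
    (\mxcol_(i < N) Eblock F (lift ord0 i) ord0) (lowermx + uppermx 1).
Proof.
rewrite /Emx mxblock_recul castmx_comp castmx_id; congr block_mx.
  apply: eq_mxrow => s; rewrite /Eblock /upper lift0 add0n addn0 subSS.
  by rewrite modn_small ?ltnS ?leq_subr // /coefs leq_subr.
rewrite -mxblockD; apply: eq_mxblock => i s.
have [iN sN] := (ltn_ord i, ltn_ord s).
rewrite /Eblock !lift0 /lower /upper; have [le_si|lt_is] := leqP s i.
  rewrite (@coefs_out _ _ _ F (i + (N - s) + 1)) ?addr0; last by lia.
  rewrite addSn subSS -addnBAC // modnDr modn_small; last by lia.
  by rewrite /coefs ifT //; lia.
rewrite add0r addSn subSS modn_small; last by lia.
rewrite /coefs ifT; last by lia.
by congr (F (inord _)); lia.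
Qed.

(** * Block rows of the projection onto the shifted part *)

Definition upper_row t := \mxrow_(s < N) upper 0 t s.

Lemma upper_rowE t (i : 'I_N) : upper_row (i + t) = submxcol (uppermx t) i.
Proof.
rewrite /uppermx mxblockEv mxcolK; apply: eq_mxrow => s.
by rewrite /upper addn0 addnAC.
Qed.

Lemma Bmx_upper : Bmx F = upper_row 0 *m (uppermx 0)^t*.
Proof.
rewrite /Bmx /ABCDmx Emx_block mulmx_block block_mxKur mulmx0 add0r UmxE.
rewrite raddfD raddfD /= mulmxDr [X in X + _](_ : _ = 0) ?add0r //.
rewrite adj_mxblock mul_mxrow_mxblock -[RHS]mxrow0; apply: eq_mxrow => l.
exact: upper_lower_adj.
Qed.

(** The first summand keeps the part [F u_+], the second shifts [F u_-]. *)
Lemma Dmx_split :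
  Dmx F = lowermx *m lowermx^t* + uppermx 1 *m (uppermx 0)^t*.
Proof.
rewrite /Dmx /ABCDmx Emx_block mulmx_block block_mxKdr mulmx0 add0r UmxE.
rewrite raddfD raddfD /= mulmxDr !mulmxDl.
by rewrite mulmx_upper_lower_adj mulmx_lower_upper_adj addr0 add0r.
Qed.

(** The projection [P] annihilates the columns of [lowermx] and fixes those
    of [uppermx 1], since [lowermx *m lowermx^t*] kills the latter. *)
Lemma upper_gram_mul_Dmx :
  uppermx 0 *m (uppermx 0)^t* *m Dmx F = uppermx 1 *m (uppermx 0)^t*.
Proof.
pose P := uppermx 0 *m (uppermx 0)^t*; rewrite -/P.
have P_lower : P *m lowermx = 0.
  rewrite -mulmxA -[X in _ *m (_ *m X)]trmxCK -adj_mulmx.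
  by rewrite mulmx_lower_adj_upper trmx0 map_mx0 mulmx0.
have P_upper : P *m uppermx 1 = uppermx 1.
  rewrite -[RHS]mul1mx -lower_upper_coisometry mulmxDl -[X in _ = X + _]mulmxA.
  by rewrite mulmx_lower_adj_upper mulmx0 add0r.
by rewrite Dmx_split mulmxDr !mulmxA P_lower mul0mx add0r P_upper.
Qed.

(** Block row [k] of [upper_gram_mul_Dmx]: block row [k] of [uppermx 1] is the
    formal block row [k + 1] of [uppermx 0], which exists even for
    [k + 1 = N]. *)
Lemma upper_row_mul_Dmx (k : 'I_N) :
  upper_row k *m (uppermx 0)^t* *m Dmx F = upper_row k.+1 *m (uppermx 0)^t*.
Proof.
rewrite -{1}(addn0 k) -addn1 !upper_rowE !submxcol_mul.
by rewrite upper_gram_mul_Dmx.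
Qed.

Lemma Bmx_mul_Dmx_exp k : (k <= N)%N ->
  Bmx F *m Dmx F ^+ k = upper_row k *m (uppermx 0)^t*.
Proof.
elim: k => [|k IHk] kN; first by rewrite expr0 mulmx1 Bmx_upper.
rewrite exprSr -mulmxE mulmxA IHk ?(ltnW kN) //.
exact: (upper_row_mul_Dmx (Ordinal kN)).
Qed.

(** Block row [N] only involves coefficients [f (N + (N - s))] with [s < N],
    all beyond the degree. *)
Lemma Bmx_mul_Dmx_expN : Bmx F *m Dmx F ^+ N = 0.
Proof.
rewrite Bmx_mul_Dmx_exp // /upper_row.
rewrite (_ : \mxrow_(s < N) _ = 0) ?mul0mx //.
rewrite -[RHS]mxrow0; apply: eq_mxrow => s.
by rewrite /upper coefs_out //; have := ltn_ord s; lia.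
Qed.

End Realization.

Local Open Scope complex_scope.

Theorem proposition2p8 (R : realType) (M N : nat) (hM : (1 <= M)%N)
    (hN : (1 <= N)%N) (F : 'I_N.+1 -> 'M[R[i]]_(2 * M)) (hF : QMF F) :
  Bmx F *m Dmx F ^+ N = 0.
Proof. exact: Bmx_mul_Dmx_expN. Qed.
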